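(* Let $C\in\mathbb{R}_+^{n\times m}$, $r\in\Delta^n$, $c\in\Delta^m$, $\alpha,\beta>0$, $\tau_1,\tau_2>0$, $\eta\ge 0$, and assume $\tau_1\eta\le 1$. Let $\{p^t\}_{t\ge0}$ and $\{\bar p^{t}\}_{t\ge1}$ be the primal sequences generated by the Primal-Dual Mirror Prox (PDMP) recursion, and let $\{\nu^t\}_{t\ge0}$, $\{\bar\nu^t\}_{t\ge1}$ and $\{\eta_t\}_{t\ge0}$ (with $\eta_0=\infty$) be the sequences generated by the Log-Averaged Mirror Prox (LAMP) recursion, both run with the same inputs. Then for all $t\ge 0$, $$p^t=p^{\eta_t}(\nu^t),\qquad \bar p^{t+1}=p^{\eta_{t+1}}(\bar\nu^{t+1}).$$
   Context: Notation. $\Delta^k$ is the probability simplex in $\mathbb{R}^k$; $\{\Delta^m\}^n$ is the set of $n\times m$ row-stochastic matrices; $\|C\|_\infty=\max_{ij}|C_{ij}|$; $\mathcal{D}_r$ is the diagonal matrix with diagonal $r$; $\mathbf{c}_r(p)\in\mathbb{R}^m$ is the vector of column sums of $\mathcal{D}_r p$, i.e. $\mathbf{c}_r(p)_j=\sum_i r_ip_{ij}$; $\mathbf 1_m$, $\mathbf 0_m$ are the all-ones and all-zeros vectors; $c^\alpha=c+(\alpha/m)\mathbf 1_m$. Dual-to-primal map. For $\theta\in[-1,1]^m$ and $\gamma\in(0,\infty]$, $p^\gamma(\theta)\in\{\Delta^m\}^n$ is $$p^\gamma(\theta)_{ij}=\frac{\exp[-\gamma^{-1}(C_{ij}+2\|C\|_\infty\theta_j)]}{\sum_{k}\exp[-\gamma^{-1}(C_{ik}+2\|C\|_\infty\theta_k)]},$$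 with $\gamma^{-1}=0$ for $\gamma=\infty$, so that $p^\infty(\theta)_{ij}=1/m$. Mirror maps. For $\tau>0$, $\eta\ge0$ the primal mirror map sends an entrywise positive $p^0\in\{\Delta^m\}^n$ and $\theta\in[-1,1]^m$ to the row-stochastic matrix $$\mathcal{M}^\eta_\tau(p^0;\theta)_{ij}=\frac{(p^0_{ij})^{1-\tau\eta}}{Z_i}\exp[-\tau(C_{ij}+2\|C\|_\infty\theta_j)],$$ where $Z_i$ normalizes row $i$ to sum to one. The dual mirror map sends $\theta^0\in(-1,1)^m$ and $p\in\{\Delta^m\}^n$ to $$\mathcal{M}^\eta_\tau(\theta^0;p)_j=\tanh\Bigl[\frac{2\tau\|C\|_\infty}{c^\alpha_j}(\mathbf{c}_r(p)_j-c_j)+\frac12\log\frac{1+\theta^0_j}{1-\theta^0_j}\Bigr].$$ (These are the closed forms of the KL-proximal primal step and the dual-entropy-proximal dual step for the saddle function $\langle C,\mathcal{D}_rp\rangle+2\|C\|_\infty\langle\theta,\mathbf c_r(p)-c\rangle-\eta H(\mathcal{D}_rp)$, where $H$ is the Shannon entropy.) The map $\operatorname{tclip}(\theta,\beta)$ clips each coordinate of $\theta$ to the interval $[-\tanh(\beta/2),\tanh(\beta/2)]$. PDMP recursion. $p^0_{ij}=1/m$, $\theta^0=\mathbf 0_m$, and for $t\ge0$: $\bar p^{t+1}=\mathcal{M}^\eta_{\tau_1}(p^t;\theta^t)$, $\bar\theta^{t+1}=\mathcal{M}^\eta_{\tau_2}(\theta^t;p^t)$, $p^{t+1}=\mathcal{M}^\eta_{\tau_1}(p^t;\bar\theta^{t+1})$,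 $\hat\theta^{t+1}=\mathcal{M}^\eta_{\tau_2}(\theta^t;\bar p^{t+1})$, $\theta^{t+1}=\operatorname{tclip}(\hat\theta^{t+1},\beta)$. LAMP recursion. $\theta^0=\nu^0=\mathbf 0_m$, $\eta_0=\infty$, and for $t\ge0$: $\eta_{t+1}=\eta_t/(1+\tau_1(\eta_t-\eta))$ (interpreted for $t=0$ as the limit $\eta_0\to\infty$, i.e. $\eta_1=1/\tau_1$), $\bar\nu^{t+1}=\nu^t+\tau_1\eta_{t+1}(\theta^t-\nu^t)$, $\bar\theta^{t+1}=\mathcal{M}^\eta_{\tau_2}(\theta^t;p^{\eta_t}(\nu^t))$, $\nu^{t+1}=\nu^t+\tau_1\eta_{t+1}(\bar\theta^{t+1}-\nu^t)$, $\hat\theta^{t+1}=\mathcal{M}^\eta_{\tau_2}(\theta^t;p^{\eta_{t+1}}(\bar\nu^{t+1}))$, $\theta^{t+1}=\operatorname{tclip}(\hat\theta^{t+1},\beta)$. The sequences $\theta^t,\bar\theta^t,\hat\theta^t$ of the two recursions are a priori distinct objects, each defined by its own recursion. *)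

(* Defs.v *)
From HB Require Import structures.
From mathcomp Require Import all_boot all_order all_algebra.
From mathcomp Require Import all_classical all_reals all_analysis.
Set Implicit Arguments.
Unset Strict Implicit.
Unset Printing Implicit Defensive.
Import Order.TTheory GRing.Theory Num.Theory.
Import numFieldNormedType.Exports.
Local Open Scope ring_scope.

Section Definitions.
Context {R : realType}.

Definition simplex k (x : 'rV[R]_k) : Prop :=
  (forall j, 0 <= x 0 j) /\ \sum_(j < k) x 0 j = 1.

Definition tanh (x : R) : R :=
  (expR x - expR (- x)) / (expR x + expR (- x)).

Section Maps.
Context {n m : nat}.
Implicit Types (C p w : 'M[R]_(n, m)) (r : 'rV[R]_n) (c theta : 'rV[R]_m).

Definition row_normalize w : 'M[R]_(n, m) :=
  \matrix_(i, j) (w i j / \sum_(k < m) w i k).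

Definition colsums r p : 'rV[R]_m := \row_j \sum_(i < n) r 0 i * p i j.

Definition smoothed (alpha : R) c : 'rV[R]_m :=
  c + (alpha / m%:R) *: const_mx 1.

(* On matrices, [`|C|] is the entrywise maximum norm.  On extended reals, the
   inverse of [+oo] is [0], so [gamma = +oo] gives the uniform matrix. *)
Definition dual_to_primal C (gamma : \bar R) theta : 'M[R]_(n, m) :=
  row_normalize (\matrix_(i, j)
    expR (- fine (gamma^-1)%E * (C i j + 2 * `|C| * theta 0 j))).

Definition primal_mirror C (eta tau : R) p theta : 'M[R]_(n, m) :=
  row_normalize (\matrix_(i, j)
    (p i j `^ (1 - tau * eta)
      * expR (- tau * (C i j + 2 * `|C| * theta 0 j)))).

(* The entropic weight [eta] of the saddle function does not enter the closed
   form of the dual step. *)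
Definition dual_mirror C r c (alpha tau : R) theta p : 'rV[R]_m :=
  \row_j tanh (2 * tau * `|C| / smoothed alpha c 0 j
                 * (colsums r p 0 j - c 0 j)
               + 2^-1 * ln ((1 + theta 0 j) / (1 - theta 0 j))).

Definition tclip theta (beta : R) : 'rV[R]_m :=
  \row_j Num.max (- tanh (beta / 2)) (Num.min (tanh (beta / 2)) (theta 0 j)).

(* The value at [+oo] is the limit of the formula for [x] finite; the sequence
   never takes the value [-oo]. *)
Definition next_eta (eta tau1 : R) (x : \bar R) : \bar R :=
  match x with
  | x%:E => (x / (1 + tau1 * (x - eta)))%:E
  | +oo%E => (tau1^-1)%:E
  | -oo%E => 0%E
  end.

(* In the two records below, the value at index 0 of the sequences [pbar],
   [thetabar], [thetahat] and [nubar] is irrelevant and left unconstrained. *)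
Record is_PDMP C r c (alpha beta tau1 tau2 eta : R)
    (p pbar : nat -> 'M[R]_(n, m))
    (theta thetabar thetahat : nat -> 'rV[R]_m) : Prop := IsPDMP {
  pdmp_p0 : p 0%N = const_mx (m%:R^-1) ;
  pdmp_theta0 : theta 0%N = 0 ;
  pdmp_pbar : forall t,
    pbar t.+1 = primal_mirror C eta tau1 (p t) (theta t) ;
  pdmp_thetabar : forall t,
    thetabar t.+1 = dual_mirror C r c alpha tau2 (theta t) (p t) ;
  pdmp_p : forall t,
    p t.+1 = primal_mirror C eta tau1 (p t) (thetabar t.+1) ;
  pdmp_thetahat : forall t,
    thetahat t.+1 = dual_mirror C r c alpha tau2 (theta t) (pbar t.+1) ;
  pdmp_theta : forall t, theta t.+1 = tclip (thetahat t.+1) beta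
}.

Record is_LAMP C r c (alpha beta tau1 tau2 eta : R)
    (etas : nat -> \bar R)
    (nu nubar theta thetabar thetahat : nat -> 'rV[R]_m) : Prop := IsLAMP {
  lamp_theta0 : theta 0%N = 0 ;
  lamp_nu0 : nu 0%N = 0 ;
  lamp_eta0 : etas 0%N = +oo%E ;
  lamp_eta : forall t, etas t.+1 = next_eta eta tau1 (etas t) ;
  lamp_nubar : forall t,
    nubar t.+1 = nu t + (tau1 * fine (etas t.+1)) *: (theta t - nu t) ;
  lamp_thetabar : forall t,
    thetabar t.+1 = dual_mirror C r c alpha tau2 (theta t)
                      (dual_to_primal C (etas t) (nu t)) ;
  lamp_nu : forall t,
    nu t.+1 = nu t + (tau1 * fine (etas t.+1)) *: (thetabar t.+1 - nu t) ;
  lamp_thetahat : forall t,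
    thetahat t.+1 = dual_mirror C r c alpha tau2 (theta t)
                      (dual_to_primal C (etas t.+1) (nubar t.+1)) ;
  lamp_theta : forall t, theta t.+1 = tclip (thetahat t.+1) beta
}.

End Maps.
End Definitions.

(* Main.v *)
Require Import Defs.
From mathcomp Require Import all_boot all_order all_algebra.
From mathcomp Require Import all_classical all_reals all_analysis.
From mathcomp Require Import ring.
Import Order.TTheory GRing.Theory Num.Theory.
Import numFieldNormedType.Exports.
Local Open Scope ring_scope.

(* In terms of the inverse temperature g = 1/gamma, the step
   e |-> e / (1 + tau (e - eta)) is the affine map
   g |-> (1 - tau eta) g + tau, with g = 0 at e = +oo.  The primal mirror map
   raises the Gibbs weights exp(-g (C + 2|C| nu)) to the power 1 - tau eta and
   multiplies them by exp(-tau (C + 2|C| theta)), so it yields Gibbs weights of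
   inverse temperature g' = (1 - tau eta) g + tau at the average nu' with
   g' nu' = (1 - tau eta) g nu + tau theta; row normalization absorbs the
   factor coming from the old normalizing constants. *)

Section GibbsStep.
Context {R : realType}.

Lemma row_normalize_scale n m (s : 'I_n -> R) (v w : 'M[R]_(n, m)) :
  (forall i, s i != 0) -> (forall i j, v i j = s i * w i j) ->
  row_normalize v = row_normalize w.
Proof.
move=> s0 vE; apply/matrixP => i j; rewrite !mxE.
under eq_bigr do rewrite vE.
by rewrite -mulr_sumr vE -mulf_div divff ?mul1r.
Qed.

Lemma dual_to_primal_pinfty n m (C : 'M[R]_(n, m)) theta :
  dual_to_primal C +oo%E theta = const_mx (m%:R^-1).
Proof.
apply/matrixP => i j; rewrite !mxE.
under eq_bigr do rewrite !mxE invey /= oppr0 mul0r expR0.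
by rewrite invey /= oppr0 mul0r expR0 sumr_const card_ord div1r.
Qed.

Section NextEta.
Variables (eta tau : R) (e : \bar R).
Hypotheses (tau_gt0 : 0 < tau) (tau_eta : tau * eta <= 1) (e_gt0 : (0 < e)%E).

Lemma next_eta_gt0 : (0 < next_eta eta tau e)%E.
Proof.
case: e e_gt0 => [x| |] //=; rewrite !lte_fin ?invr_gt0// => x0.
(* The denominator regroups as [tau * x + (1 - tau * eta)], a positive plus a nonnegative term. *)
apply: divr_gt0 => //; by rewrite mulrBr addrCA ltr_pwDl ?mulr_gt0 ?subr_ge0.
Qed.

Lemma fine_next_etaV : fine (next_eta eta tau e)^-1%E =
  (1 - tau * eta) * fine e^-1%E + tau.
Proof.
case: e e_gt0 next_eta_gt0 => [x| |] //=; rewrite !lte_fin => x0 y0.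
  rewrite !inver !gt_eqF//= invf_div.
  by field; rewrite gt_eqF.
by rewrite inver invr_eq0 gt_eqF//= invrK mulr0 add0r.
Qed.

(** [next_eta] is finite even at [e = +oo], so the averaging weight
    [tau * fine (next_eta eta tau e)] is [tau] over the new inverse temperature. *)
Lemma fine_next_etaVK :
  fine (next_eta eta tau e)^-1%E * fine (next_eta eta tau e) = 1.
Proof.
have : next_eta eta tau e \is a fin_num by case: e e_gt0.
move: next_eta_gt0; case: next_eta => [y| |] //=; rewrite lte_fin => y0 _.
by rewrite inver gt_eqF//= mulVf ?gt_eqF.
Qed.

Lemma primal_mirror_dual_to_primal n m (C : 'M[R]_(n, m)) nu theta :
  primal_mirror C eta tau (dual_to_primal C e nu) theta =
  dual_to_primal C (next_eta eta tau e)
    (nu + (tau * fine (next_eta eta tau e)) *: (theta - nu)).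
Proof.
pose S i := \sum_(k < m) expR (- fine e^-1%E * (C i k + 2 * `|C| * nu 0 k)).
have S_ge0 i : 0 <= S i by apply: sumr_ge0 => k _; exact: expR_ge0.
(* Without columns the sums [S i] vanish, but then there are no entries to compare. *)
have [m0|m_gt0] := posnP m.
  by subst m; apply/matrixP => i [].
have S_gt0 i : 0 < S i.
  rewrite /S (bigD1 (Ordinal m_gt0))//= ltr_pwDl ?expR_gt0//.
  by apply: sumr_ge0 => k _; exact: expR_ge0.
apply: (@row_normalize_scale _ _ (fun i => (S i)^-1 `^ (1 - tau * eta))).
  by move=> i; rewrite gt_eqF// powR_gt0// invr_gt0.
move=> i j; rewrite !mxE.
under eq_bigr do rewrite !mxE.
rewrite -/(S i) powRM ?expR_ge0 ?invr_ge0// -expRM mulrAC -expRD mulrC.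
congr (_ * expR _).
have:= fine_next_etaVK; rewrite fine_next_etaV.
set g := fine _^-1%E; set f := fine _ => gf.
(* The middle term isolates the product that [gf] equates to 1; the rest is polynomial identity. *)
transitivity (- ((1 - tau * eta) * g + tau) * (C i j + 2 * `|C| * nu 0 j)
  - 2 * `|C| * tau * ((((1 - tau * eta) * g + tau) * f) * (theta 0 j - nu 0 j))).
  by rewrite gf; ring.
by ring.
Qed.

End NextEta.
End GibbsStep.

Theorem proposition3p2 (R : realType) (n m : nat)
    (C : 'M[R]_(n, m)) (r : 'rV[R]_n) (c : 'rV[R]_m)
    (alpha beta tau1 tau2 eta : R)
    (hC : forall i j, 0 <= C i j)
    (hr : simplex r) (hc : simplex c)
    (halpha : 0 < alpha) (hbeta : 0 < beta)
    (htau1 : 0 < tau1) (htau2 : 0 < tau2)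
    (heta : 0 <= eta) (htau1eta : tau1 * eta <= 1)
    (p pbar : nat -> 'M[R]_(n, m))
    (theta thetabar thetahat : nat -> 'rV[R]_m)
    (etas : nat -> \bar R)
    (nu nubar theta' thetabar' thetahat' : nat -> 'rV[R]_m)
    (hPDMP : is_PDMP C r c alpha beta tau1 tau2 eta
               p pbar theta thetabar thetahat)
    (hLAMP : is_LAMP C r c alpha beta tau1 tau2 eta
               etas nu nubar theta' thetabar' thetahat') :
  forall t : nat,
    p t = dual_to_primal C (etas t) (nu t) /\
    pbar t.+1 = dual_to_primal C (etas t.+1) (nubar t.+1).

Proof.
have etas_gt0 t : (0 < etas t)%E.
  elim: t => [|t IHt]; first by rewrite (lamp_eta0 hLAMP).
  by rewrite (lamp_eta hLAMP) next_eta_gt0.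
have pbarE t : p t = dual_to_primal C (etas t) (nu t) -> theta t = theta' t ->
    pbar t.+1 = dual_to_primal C (etas t.+1) (nubar t.+1).
  move=> pE thetaE; rewrite (pdmp_pbar hPDMP) (lamp_nubar hLAMP).
  by rewrite (lamp_eta hLAMP) pE thetaE primal_mirror_dual_to_primal.
(* The two [theta] sequences are separate data whose updates use the primal iterates, so their
   equality must be carried in the same induction. *)
have same t : p t = dual_to_primal C (etas t) (nu t) /\ theta t = theta' t.
  elim: t => [|t [pE thetaE]].
    rewrite (pdmp_p0 hPDMP) (lamp_eta0 hLAMP) dual_to_primal_pinfty.
    by rewrite (pdmp_theta0 hPDMP) (lamp_theta0 hLAMP).
  split; last first.
    rewrite (pdmp_theta hPDMP) (pdmp_thetahat hPDMP) (pbarE t)// thetaE.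
    by rewrite (lamp_theta hLAMP) (lamp_thetahat hLAMP).
  rewrite (pdmp_p hPDMP) (pdmp_thetabar hPDMP) thetaE pE.
  (* With equal inputs, both recursions take the same extrapolated dual step. *)
  rewrite -(lamp_thetabar hLAMP) (lamp_nu hLAMP) (lamp_eta hLAMP).
  by rewrite primal_mirror_dual_to_primal.
by move=> t; have [pE thetaE] := same t; split => //; exact: pbarE.
Qed.
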